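(* Let $G$ be a finite abelian group with $n$ elements, and let $S\subseteq G$ be a generating set of $G$ with $S=-S$ and $0_G\notin S$. Then the cop number of the undirected Cayley graph $\mathrm{Cay}(G,S)$ satisfies $$c(\mathrm{Cay}(G,S))\le \frac{1}{\sqrt{(\sqrt{2}-1)\,e}}\,\sqrt{n}+\frac{7}{2}.$$
   Context: Cops and robbers is played on a finite connected graph. First each cop chooses a starting vertex, then the robber chooses a starting vertex. Then cop turns and robber turns alternate, starting with a cop turn. On a cop turn each cop moves to a neighbouring vertex or stays where it is; on a robber turn the robber does likewise. Several cops may share a vertex, and all players have full information. The cops win if at some point a cop shares a vertex with the robber; the robber wins if this never happens. The cop number $c(\Gamma)$ is the minimum number of cops for which the cops have a winning strategy on $\Gamma$. For a finite abelian group $(G,+)$ and a generating set $S$ with $0_G\notin S$ and $S=-S$, $\mathrm{Cay}(G,S)$ is the undirected graph with vertex set $G$ in which $u,v$ are adjacent iff $v-u\in S$. Here $e$ is the base of the natural logarithm. *)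

(* Defs.v *)
From HB Require Import structures.
From mathcomp Require Import all_boot all_order all_fingroup all_algebra.
From mathcomp Require Import boolp reals sequences exp.

Set Implicit Arguments.
Unset Strict Implicit.
Unset Printing Implicit Defensive.

Import Order.TTheory GRing.Theory Num.Theory.

Section CopsAndRobbers.
Variables (V : finType) (adj : rel V).

Definition may_move (u v : V) : bool := (v == u) || adj u v.

(* r t is the robber's vertex after t robber turns; r 0 is the initial choice. *)
Definition robber_play (r : nat -> V) : Prop :=
  forall t, may_move (r t) (r t.+1).

(* A (deterministic) strategy for k cops maps the list of all the robber's
   positions so far, oldest first, to the cops' positions. The value at [::] is
   the initial placement, chosen before the robber's; the cops' own past
   positions are the values at the prefixes, so all of the history is available. *)
Definition cop_strategy (k : nat) := seq V -> {ffun 'I_k -> V}.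

Definition cops_at k (s : cop_strategy k) (r : nat -> V) (t : nat) :
  {ffun 'I_k -> V} := s (mkseq r t).

Definition legal k (s : cop_strategy k) : Prop :=
  forall r, robber_play r ->
  forall t i, may_move (cops_at s r t i) (cops_at s r t.+1 i).

(* After t cop turns, the robber moves (or, for t = 0, is placed) to r t, then
   the cops move to cops_at s r t.+1: the two disjuncts are a capture after the
   robber's action and after the cop turn that follows it. *)
Definition captures k (s : cop_strategy k) (r : nat -> V) : Prop :=
  exists t i, cops_at s r t i = r t \/ cops_at s r t.+1 i = r t.

Definition winning k (s : cop_strategy k) : Prop :=
  legal s /\ forall r, robber_play r -> captures s r.

Definition cops_win (k : nat) : Prop := exists s : cop_strategy k, winning s.

Lemma cops_win_card : cops_win #|V|.
Proof.
exists (fun=> [ffun i => enum_val i]); split=> [r _ t i|r _].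
  by rewrite /may_move eqxx.
by exists 0, (enum_rank (r 0)); left; rewrite /cops_at ffunE enum_rankK.
Qed.

Lemma ex_cops_win : exists k, `[< cops_win k >].
Proof. by exists #|V|; apply/asboolP; exact: cops_win_card. Qed.

Definition cop_number : nat := ex_minn ex_cops_win.

Lemma cop_numberP :
  cops_win cop_number /\ forall k, cops_win k -> cop_number <= k.
Proof.
rewrite /cop_number; case: ex_minnP => m /asboolP wm minm.
by split=> // k wk; apply/minm/asboolP.
Qed.

End CopsAndRobbers.

Section Cayley.
Local Open Scope ring_scope.
Variables (G : finZmodType) (S : {set G}).

Definition Cay : rel G := fun u v => v - u \in S.

Lemma Cay_irreflexive : 0 \notin S -> irreflexive Cay.
Proof. by move=> S0 u; rewrite /Cay subrr; apply/negbTE. Qed.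

Lemma Cay_symmetric : S = [set - x | x in S] -> symmetric Cay.
Proof.
move=> SN; have sub u v : Cay u v -> Cay v u.
  by rewrite /Cay => uv; rewrite SN -opprB imset_f.
by move=> u v; apply/idP/idP; apply: sub.
Qed.

(* <<S>>%g is the subgroup generated by S for the additive group of G. *)
Lemma Cay_connected : <<S>>%g = [set: G] -> forall u v, connect Cay u v.
Proof.
move=> genS u v; have /gen_prodgP[n [c Sc vE]] : v - u \in <<S>>%g.
  by rewrite genS in_setT.
have {vE} -> : v = u + (\prod_(i < n) c i)%g by rewrite -vE addrC subrK.
elim: n c Sc u => [|n IHn] c Sc u; first by rewrite big_ord0 addr0.
rewrite big_ord_recl /= FinRing.zmodMgE addrA.
have uc : Cay u (u + c ord0) by rewrite /Cay addrAC subrr add0r.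
by apply: connect_trans (connect1 uc)
  (IHn (fun i => c (lift ord0 i)) _ _) => i; apply: Sc.
Qed.

End Cayley.

(* Main.v *)
(* Only the differences [robber - cop] matter, and the cops try to bring one of
   them into a subgroup [H], starting from arbitrary positions; [H = 0] is the
   game itself, and larger [H] play the role of quotients of the group. A cop
   whose difference lies in [H + <x>] guards every robber move [u] such that
   [u + x] is a cop move modulo [H]: he answers [u] by [u + x], subtracting [x]
   from his difference, and copies all other moves, so that guarded moves can be
   played only finitely often. By induction the cops bring one of them into the
   larger subgroup [H + <x>], and the others go on against a robber with fewer
   moves. If [k] and [n] are the numbers of nonzero robber moves and of elements
   modulo [H], averaging gives an [x] guarding a proportion [k / n] of the moves,
   while [x = - u - w] always guards two of them. Guards of the first kind
   followed by guards of the second kind give the bound. *)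
Require Import Defs.
From HB Require Import structures.
From mathcomp Require Import all_boot all_order all_fingroup all_algebra.
From mathcomp Require Import boolp reals sequences exp.
From mathcomp Require Import zify ring lra.
Import Order.TTheory GRing.Theory Num.Theory.
Local Open Scope ring_scope.

(** * Additive subgroups and their extension by one element *)

Section AdditiveSubgroups.
Set Implicit Arguments.
Unset Strict Implicit.
Variables (G : finZmodType) (H : {group G}).
Implicit Types x y z : G.

Lemma group_add0 : 0 \in H. Proof. exact: (group1 H). Qed.

Lemma group_addN x : x \in H -> - x \in H.
Proof. by move=> Hx; have := groupVr Hx. Qed.

Lemma group_addD x y : x \in H -> y \in H -> x + y \in H.
Proof. by move=> Hx Hy; have := groupM Hx Hy. Qed.

Lemma group_addB x y : x \in H -> y \in H -> x - y \in H.
Proof. by move=> Hx /group_addN; apply: group_addD. Qed.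

Lemma group_addBC x y : x - y \in H -> y - x \in H.
Proof. by move/group_addN; rewrite opprB. Qed.

Lemma group_addB_trans y x z : x - y \in H -> y - z \in H -> x - z \in H.
Proof. by move=> xy yz; have := group_addD xy yz; rewrite addrA subrK. Qed.

Lemma mem_joing_cycle x z :
  (z \in H <*> <[x]>)%g -> exists j, z - x *+ j \in H.
Proof.
have cHx : <[x]>%g \subset 'C(H)%g.
  by apply/centsP => a _ b _; rewrite /commute !FinRing.zmodMgE addrC.
rewrite /= cent_joinEr // => /mulsgP[h y Hh /cycleP[j ->] ->].
by exists j; rewrite FinRing.zmodXgE FinRing.zmodMgE addrK.
Qed.

(** A proper subgroup has index at least 2. This halving of the quotient is the source of
    [Num.sqrt 2] in the constant. *)
Lemma card_joing_cycle x :
  x \notin H -> (2 * #|H| <= #|(H <*> <[x]>)%G|)%N.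
Proof.
move=> xH; have HK : H \subset (H <*> <[x]>)%G by apply: joing_subl.
have /dvdnP[q qE] := cardSg HK.
have : (#|H| < #|(H <*> <[x]>)%G|)%N.
  apply: proper_card; rewrite properE HK; apply: contraNN xH => /subsetP; apply.
  by apply: (subsetP (joing_subr H <[x]>%g)); apply: cycle_id.
by rewrite qE leq_mul2r -{1}[#|H|]mul1n ltn_mul2r => /andP[_ ->]; rewrite orbT.
Qed.

Lemma codim_joing_cycle x :
  x \notin H -> (#|G| - #|(H <*> <[x]>)%G| < #|G| - #|H|)%N.
Proof.
move=> /card_joing_cycle HK; have H0 := cardG_gt0 H.
have KG : (#|(H <*> <[x]>)%G| <= #|G|)%N by apply: max_card.
by apply: ltn_sub2l; lia.
Qed.

End AdditiveSubgroups.

(** * The pursuit of differences modulo a subgroup *)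

Section Pursuit.
Set Implicit Arguments.
Unset Strict Implicit.
Variables (G : finZmodType) (S0 : {set G}) (I : finType).
Hypothesis S0_0 : 0 \in S0.
Implicit Types (H K U : {set G}) (A : {set I}) (d : I -> G).

Definition robber_move H U (v : G) : bool :=
  (v \in S0) && ((v \in H) || [exists u in U, v - u \in H]).

(* [d i] is the robber's position minus that of cop [i], just before a robber
   turn; the cops of [A] aim at bringing some [d i] into [H]. *)
Inductive win H U A : (I -> G) -> Prop :=
| win_hit d i : i \in A -> d i \in H -> win H U A d
| win_step d (s : G -> I -> G) : (forall v i, s v i \in S0) ->
    (forall v, robber_move H U v -> win H U A (fun i => d i + v - s v i)) ->
    win H U A d.

(** Quantifying over [A] and [d] allows a cop to be set aside as a guard and the others to start
    afresh from wherever they stand. *)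
Definition cops_force H U (m : nat) : Prop :=
  forall A d, (m <= #|A|)%N -> win H U A d.

Lemma cops_force_leq H U m m' :
  (m <= m')%N -> cops_force H U m -> cops_force H U m'.
Proof. by move=> mm' P A d /(leq_trans mm'); apply: P. Qed.

Lemma win_subset H K U U' A d : H \subset K ->
  (forall v, robber_move H U v -> robber_move K U' v) ->
  win K U' A d ->
  (forall i d', i \in A -> d' i \in K -> win H U A d') -> win H U A d.
Proof.
move=> HK sub w hit; elim: w => {}d; first by move=> i; apply: hit.
move=> s Ss _ IH; apply: (@win_step _ _ _ _ s) => // v /sub; apply: IH.
Qed.

Lemma cops_force_mod (H : {group G}) U U' m :
  (forall u, u \in U -> u \in H \/ exists2 u', u' \in U' & u - u' \in H) ->
  cops_force H U' m -> cops_force H U m.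
Proof.
move=> UU' P A d /P w.
apply: (win_subset (subxx H) _ (w d)); last first.
  by move=> i d'; apply: win_hit.
move=> v /andP[Sv] /orP[Hv|/exists_inP[u Uu vu]]; rewrite /robber_move Sv /=.
  by rewrite Hv.
have [Hu|[u' U'u' uu']] := UU' _ Uu.
  by rewrite -[v](subrK u) (group_addD vu Hu).
apply/orP; right; apply/exists_inP; exists u' => //.
exact: group_addB_trans vu uu'.
Qed.

Lemma cops_force_subset (H : {group G}) (U U' : {set G}) m :
  U \subset U' -> cops_force H U' m -> cops_force H U m.
Proof.
move=> /subsetP UU'; apply: cops_force_mod => u Uu; right; exists u; rewrite ?UU' //.
by rewrite subrr group_add0.
Qed.

(* A cop [i] with [d i] in [H + j x] answers every robber move outside [U'] by
   one that lowers [j], and copies the other robber moves. *)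
Lemma guard_win (H : {group G}) U U' (x : G) m A i :
  (forall u, u \in U -> u \in U' \/ exists2 s, s \in S0 & u + x - s \in H) ->
  cops_force H U' m -> i \in A -> (m < #|A|)%N ->
  forall j d, d i - x *+ j \in H -> win H U A d.
Proof.
move=> UU' P Ai mA; elim=> [|j IHj] d dj.
  by apply: (@win_hit _ _ _ _ i) => //; rewrite mulr0n subr0 in dj.
(* Inner induction on a win of the other cops against [U']. Cop [i] only copies meanwhile, so [d']
   has to agree with [d0] off [i] only. *)
suff gen d0 : win H U' (A :\ i) d0 -> forall d', d' i - x *+ j.+1 \in H ->
    {in A :\ i, d' =1 d0} -> win H U A d'.
  by apply: (gen d) => //; apply: P; move: mA; rewrite (cardsD1 i) Ai.
elim=> {d dj d0} d.
  move=> k Ak dk d' dj dd'; apply: (@win_hit _ _ _ _ k).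
    by move: Ak; rewrite !inE => /andP[].
  by rewrite dd'.
move=> s Ss _ IH d' dj dd'.
pose g v := odflt 0 [pick y in S0 | v + x - y \in H].
pose s' v k := if robber_move H U' v then if k == i then v else s v k
               else if k == i then g v else 0.
apply: (@win_step _ _ _ _ s') => [v k|v mv].
  rewrite /s'; case: ifP => [/andP[Sv _]|_]; case: ifP => // _.
  by rewrite /g; case: pickP => //= y; case/andP.
have [mv'|mv'] := boolP (robber_move H U' v).
  apply: (IH v mv') => [|k Ak]; rewrite /s' mv'; first by rewrite eqxx addrK.
  have /negPf -> : k != i by move: Ak; rewrite !inE => /andP[].
  by rewrite dd'.
(* A guarded move abandons the win in progress: the position is new, but [j] has dropped. *)
apply: IHj; rewrite /s' (negPf mv') eqxx.
have gH : v + x - g v \in H.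
  have [y Sy yH] : exists2 y, y \in S0 & v + x - y \in H.
    move: mv mv'; rewrite /robber_move => /andP[->] /= /orP[->//|].
    case/exists_inP=> u Uu vu /norP[_ /exists_inPn nU'].
    have [/nU'|[y Sy uy]] := UU' _ Uu; first by rewrite vu.
    by exists y => //; have := group_addD vu uy; rewrite !addrA subrK.
  by rewrite /g; case: pickP => [z /andP[]//|/(_ y)]; rewrite /= Sy yH.
have := group_addD dj gH; rewrite mulrS opprD.
by rewrite (AC ((1*2)*(2*1)) ((1*4*6*3)*(5*2))) /= subrr addr0.
Qed.

(** All cops first pursue [H + <x>]; whoever gets there becomes the guard, and [m] cops remain to
    face [U']. *)
Lemma cops_force_guard (H : {group G}) U U' (x : G) m :
  (forall u, u \in U -> u \in U' \/ exists2 s, s \in S0 & u + x - s \in H) ->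
  cops_force (H <*> <[x]>)%G U m.+1 -> cops_force H U' m ->
  cops_force H U m.+1.
Proof.
move=> UU' PK PH A d mA; have HK : H \subset (H <*> <[x]>)%G by apply: joing_subl.
apply: (win_subset HK _ (PK _ d mA)) => [v /andP[Sv mv]|i d' Ai].
  rewrite /robber_move Sv /=; case/orP: mv => [/(subsetP HK)->//|].
  case/exists_inP=> u Uu vu; apply/orP; right; apply/exists_inP; exists u => //.
  exact: (subsetP HK).
by case/mem_joing_cycle => j; apply: (guard_win UU' PH).
Qed.

Variable S : {set G}.
Hypotheses (S0S : S \subset S0) (Sgen : <<S>>%g = [set: G]).

(** The robber stays in one coset of [H], so one cop reaches it along a word in the generators. *)
Lemma cops_force_static (H : {group G}) : cops_force H set0 1.
Proof.
move=> A d /card_gt0P[i Ai].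
have /gen_prodgP[n [c Sc dE]] : d i \in <<S>>%g by rewrite Sgen in_setT.
have : d i - (\prod_(k < n) c k)%g \in H by rewrite -dE subrr group_add0.
elim: n c Sc d {dE} => [|n IHn] c Sc d dH.
  by apply: (@win_hit _ _ _ _ i) => //; rewrite big_ord0 subr0 in dH.
apply: (@win_step _ _ _ _ (fun _ k => if k == i then c ord0 else 0)) => [v k|v].
  by case: ifP => // _; apply: (subsetP S0S); apply: Sc.
case/andP=> _ /orP[Hv|/exists_inP[u]]; last by rewrite inE.
apply: (IHn (fun k => c (lift ord0 k))) => [k|]; first exact: Sc.
have := group_addD dH Hv; rewrite big_ord_recl /= FinRing.zmodMgE opprD eqxx.
by rewrite (AC ((1*2)*1) (1*4*2*3)).
Qed.

(** * Guards that remove two moves each *)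

Hypothesis SN : forall u, u \in S -> - u \in S.

Definition guarded (H : {group G}) (x u : G) : bool :=
  [exists s in S0, u + x - s \in H].

Lemma cops_force_by_guards p c :
  (forall (H : {group G}) U u, U \subset S -> (#|U| <= c)%N ->
     {in U, forall u, u \notin H} -> u \in U ->
     exists2 x, x \notin H & cops_force H [set u in U | ~~ guarded H x u] p.+1) ->
  forall (H : {group G}) U, U \subset S -> (#|U| <= c)%N -> cops_force H U p.+2.
Proof.
move=> ex_guard H; have [N] := ubnP (#|G| - #|H|).
elim: N H => // N IHN H ltN U US cardU.
apply: (@cops_force_mod _ _ (U :\: H)) => [u Uu|].
  have [uH|uH] := boolP (u \in H); [by left | right; exists u].
    by rewrite inE uH.
  by rewrite subrr group_add0.
have [->|[u Uu]] := set_0Vmem (U :\: H).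
  by apply: cops_force_leq (@cops_force_static H).
have U'S := subset_trans (subsetDl U H) US.
have cardU' := leq_trans (subset_leq_card (subsetDl U H)) cardU.
have U'H : {in U :\: H, forall v, v \notin H} by move=> v /setDP[].
have [x xH] := ex_guard _ _ _ U'S cardU' U'H Uu.
apply: (@cops_force_guard _ _ _ x) => [v Uv|]; last first.
  by apply: IHN => //; apply: leq_trans (codim_joing_cycle xH) _.
have [/exists_inP|nv] := boolP (guarded H x v); first by right.
by left; rewrite inE Uv.
Qed.

(* A cop guarding [x = - u - w] neutralises the moves [u] and [w] at once,
   answering [u] by [- w] and [w] by [- u]. *)
Lemma cops_force_half p (H : {group G}) U :
  U \subset S -> (#|U| <= 2 * p + 1)%N -> cops_force H U p.+2.
Proof.
elim: p H U => [|p IHp]; apply: cops_force_by_guards => H U u US cardU UH Uu.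
all: have uNH : - u \notin H by
  apply: contra (UH _ Uu) => /group_addN; rewrite opprK.
  exists (- u) => //; apply: cops_force_subset (@cops_force_static H).
  apply/subsetP => v; rewrite inE => /andP[Uv /exists_inP[]]; exists 0 => //.
  by rewrite (card_le1_eqP cardU _ _ Uv Uu) subr0 subrr group_add0.
have Su := subsetP US _ Uu.
have [/exists_inP[w /setD1P[wu Uw] uwH]|/exists_inPn all_opp] :=
    boolP [exists w in U :\ u, u + w \notin H].
  have Sw := subsetP US _ Uw.
  exists (- (u + w)); first by apply: contra uwH => /group_addN; rewrite opprK.
  apply: (@cops_force_subset _ _ (U :\: [set u; w])); last first.
    apply: IHp; first exact: subset_trans (subsetDl _ _) US.
    move: cardU; rewrite (cardsD1 u) Uu (cardsD1 w) !inE wu Uw.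
    by rewrite setDDl /=; clear; lia.
  apply/subsetP => v; rewrite !inE andbC => /andP[/exists_inP nv ->]; rewrite andbT.
  apply/norP; split; apply/eqP => vE; apply: nv.
    exists (- w); first exact/(subsetP S0S)/SN.
    by rewrite vE opprK opprD addrA subrr add0r addNr group_add0.
  exists (- u); first exact/(subsetP S0S)/SN.
  by rewrite vE opprK opprD addrCA subrr addr0 addNr group_add0.
(* Here all other moves are congruent to [- u], so guarding [u] leaves in effect one move. *)
exists (- u) => //; apply: (@cops_force_mod _ _ [set - u]) => [v|]; last first.
  by apply: IHp; rewrite ?cards1 ?sub1set ?SN // addnC.
rewrite inE => /andP[Uv nv]; right; exists (- u); first by rewrite inE.
rewrite opprK addrC -[_ \in _]negbK; apply: (contraNN _ nv) => uvH.
apply/exists_inP; exists 0 => //; rewrite subr0.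
have [->|vu] := eqVneq v u; first by rewrite subrr group_add0.
by have := all_opp v; rewrite !inE vu Uv => /(_ isT); rewrite uvH.
Qed.

(** * Guards found by averaging *)

Definition cop_cosets (H : {group G}) : {set G} :=
  [set v | [exists s in S0, v - s \in H]].

Lemma guardedE (H : {group G}) x u : guarded H x u = (u + x \in cop_cosets H).
Proof. by rewrite inE. Qed.

(** Double counting: each [u] is unguarded for exactly [#|G| - #|cop_cosets H|] elements [x] of [G],
    hence for at most that many outside [H]. *)
Lemma ex_good_guard (H : {group G}) U : (#|H| < #|G|)%N ->
  exists2 x, x \notin H &
    (#|[set u in U | ~~ guarded H x u]| * (#|G| - #|H|) <=
     #|U| * (#|G| - #|cop_cosets H|))%N.
Proof.
move=> HG; set C := cop_cosets H.
have [/exists_inP[x xH le]|/exists_inPn bad] := boolP [exists x in ~: H,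
    (#|[set u in U | ~~ guarded H x u]| * (#|G| - #|H|) <=
     #|U| * (#|G| - #|C|))%N].
  by exists x => //; rewrite inE in xH.
have cardC (B : {set G}) : #|~: B| = (#|G| - #|B|)%N by rewrite cardsCs setCK.
have sumE : (\sum_(x in ~: H) #|[set u in U | ~~ guarded H x u]| <=
             #|U| * (#|G| - #|C|))%N.
  apply: (@leq_trans (\sum_x \sum_(u in U) ((u + x)%R \notin C))%N).
    rewrite [leqRHS](bigID (mem (~: H))) /=; apply: leq_trans (leq_addr _ _).
    apply: leq_sum => x _; rewrite -sum1_card big_mkcond [leqRHS]big_mkcond /=.
    apply: leq_sum => u _; rewrite inE guardedE -/C.
    by case: (u \in U); case: (_ \notin C).
  rewrite exchange_big /= -sum_nat_const leq_sum // => u _.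
  rewrite (reindex_inj (addrI (- u))) /= -cardC -sum1_card.
  rewrite [leqRHS]big_mkcond leq_sum // => x _.
  by rewrite addNKr in_setC; case: (x \in C).
have : (\sum_(x in ~: H) (#|U| * (#|G| - #|C|)).+1 <=
  \sum_(x in ~: H) #|[set u in U | ~~ guarded H x u]| * (#|G| - #|H|))%N.
  by apply: leq_sum => x /bad; rewrite -ltnNge.
rewrite sum_nat_const -big_distrl /= cardC mulnC leq_pmul2r ?subn_gt0 //.
by rewrite ltnNge sumE.
Qed.

(** [U] has one move in each coset other than [H] that meets [S]. These cosets and [H] are disjoint
    and lie in [cop_cosets H]. *)
Lemma ex_transversal (H : {group G}) :
  exists U, [/\ U \subset S,
    (#|U| * #|H| + #|H| <= #|cop_cosets H|)%N &
    forall u, u \in S -> u \in H \/ exists2 w, w \in U & u - w \in H].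
Proof.
pose T := S :\: H; pose rho u := odflt u [pick w in T | u - w \in H].
have rhoP u : u \in T -> rho u \in T /\ u - rho u \in H.
  move=> Tu; rewrite /rho; case: pickP => [w /andP[]//|/(_ u)] /=.
  by rewrite Tu subrr group_add0.
have rho_eq u v : u \in T -> u - v \in H -> rho u = rho v.
  move=> Tu uv; rewrite /rho.
  have /eq_pick -> : [pred w in T | u - w \in H] =1 [pred w in T | v - w \in H].
    move=> w /=; congr (_ && _); apply/idP/idP; apply: group_addB_trans => //.
    exact: group_addBC.
  by case: pickP => [w|/(_ u)] //=; rewrite Tu group_addBC.
exists (rho @: T); split.
- apply/subsetP => _ /imsetP[u /rhoP[Tu _] ->].
  by move: Tu; rewrite inE => /andP[].
- have U0 : 0 \notin rho @: T.
    apply/imsetP => -[u /rhoP[+ _] E]; rewrite -E inE group_add0 //.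
  rewrite addnC -mulSn; have -> : (#|rho @: T|.+1 * #|H| = #|setX (0%R |: rho @: T) H|)%N.
    by rewrite cardsX cardsU1 U0.
  rewrite -(@card_in_imset _ _ (fun p => p.1 + p.2)).
    apply/subset_leq_card/subsetP => _ /imsetP[[w h] /setXP[/setU1P[->|Uw] Hh] ->].
      by rewrite inE /= add0r; apply/exists_inP; exists 0; rewrite ?subr0.
    case/imsetP: Uw => u /rhoP[+ _] ->; rewrite inE => /andP[_ /(subsetP S0S) Sw].
    by rewrite inE; apply/exists_inP; exists (rho u); rewrite //= addrAC subrr add0r.
  have eqU w w' : w \in 0 |: rho @: T -> w' \in 0 |: rho @: T ->
      w - w' \in H -> w = w'.
    case/setU1P=> [->|/imsetP[u Tu ->]]; case/setU1P=> [->|/imsetP[u' Tu' ->]] //.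
    + rewrite sub0r => /group_addN; rewrite opprK.
      by have [+ _] := rhoP _ Tu'; rewrite inE => /andP[/negPf->].
    + by rewrite subr0; have [+ _] := rhoP _ Tu; rewrite inE => /andP[/negPf->].
    + have [Tw uw] := rhoP _ Tu; have [_ u'w'] := rhoP _ Tu'.
      move=> ww'; apply: rho_eq => //; apply: group_addB_trans uw _.
      by apply: group_addB_trans ww' _; apply: group_addBC.
  move=> [w h] [w' h'] /setXP[Uw Hh] /setXP[Uw' Hh'] /= E.
  have {}Uw : w = w'.
    apply: eqU => //; have -> : w - w' = h' - h; last exact: group_addB.
    by apply/eqP; rewrite subr_eq addrAC eq_sym subr_eq addrC E.
  by move: E; rewrite Uw => /addrI ->.
- move=> u Su; have [uH|uH] := boolP (u \in H); [by left | right].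
  have Tu : u \in T by rewrite inE uH.
  by exists (rho u); [apply: imset_f | have [] := rhoP _ Tu].
Qed.

(** Starting from a transversal, each guard costs one cop and multiplies the number of moves by at
    most [1 - q <= expR (- q)]. *)
Lemma cops_force_decay (R : realType) (H : {group G}) M N j :
  let q : R := (#|cop_cosets H|%:R - #|H|%:R) / #|G|%:R in
  (#|H| < #|G|)%N ->
  (forall x, x \notin H -> cops_force (H <*> <[x]>)%G S N.+1) ->
  (N + j <= M)%N ->
  exists U, [/\ U \subset S,
    #|U|%:R <= (#|cop_cosets H|%:R - #|H|%:R) / #|H|%:R * expR (- (q * j%:R)) &
    cops_force H U (M - j) -> cops_force H S M].
Proof.
move=> q HG PK; have [U0 [U0S cardU0 U0P]] := ex_transversal H.
have H0 : 0 < #|H|%:R :> R by rewrite ltr0n cardG_gt0.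
have HG' : #|H|%:R < #|G|%:R :> R by rewrite ltr_nat.
have HC : #|H|%:R <= #|cop_cosets H|%:R :> R.
  by rewrite ler_nat (leq_trans _ cardU0) // leq_addl.
have q0 : 0 <= q by rewrite divr_ge0 ?subr_ge0.
elim: j => [|j IHj] jM.
  exists U0; split=> //; last by rewrite subn0; apply: cops_force_mod.
  rewrite mulr0 oppr0 expR0 mulr1 ler_pdivlMr // lerBrDr -natrM -natrD.
  by rewrite ler_nat.
have [|U [US cardU UP]] := IHj; first by clear -jM; lia.
have [x xH cardU'] := ex_good_guard U HG.
exists [set u in U | ~~ guarded H x u]; split.
- by apply: subset_trans US; apply/subsetP => u; rewrite inE => /andP[].
- set U' := [set u in U | _] in cardU' *.
  have e1 : #|U'|%:R <= #|U|%:R * expR (- q).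
    apply: (@le_trans _ _ (#|U|%:R * (1 - q))); last first.
      by rewrite ler_wpM2l // (le_trans _ (expR_ge1Dx _)).
    have CG : (#|cop_cosets H| <= #|G|)%N by apply: max_card.
    have aH0 : 0 < #|G|%:R - #|H|%:R :> R by rewrite subr_gt0.
    have G0 : 0 < #|G|%:R :> R := lt_trans H0 HG'.
    rewrite -(ler_pM2r aH0).
    move: cardU'; rewrite -(ler_nat R) !natrM !natrB // ?(ltnW HG) //.
    move/le_trans; apply; rewrite -mulrA ler_wpM2l //.
    have -> : #|cop_cosets H|%:R = #|H|%:R + q * #|G|%:R :> R.
      by rewrite /q mulfVK ?gt_eqF // addrC subrK.
    rewrite mulrBl mul1r opprD addrA lerD2l lerN2 ler_wpM2l //.
    by rewrite gerBl ltW.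
  apply: (le_trans e1); rewrite -natr1 mulrDr mulr1 opprD expRD mulrA.
  by rewrite ler_wpM2r // expR_ge0.
- move=> PU'; apply: UP; have -> : (M - j = (M - j.+1).+1)%N by clear -jM; lia.
  apply: (@cops_force_guard _ _ _ x) PU' => [u Uu|].
    have [/exists_inP|nu] := boolP (guarded H x u); first by right.
    by left; rewrite inE Uu.
  apply: (@cops_force_subset _ _ S) => //.
  by apply: cops_force_leq (PK x xH); clear -jM; lia.
Qed.

End Pursuit.

(** * Optimising the number of guards *)

Section Bound.
Set Implicit Arguments.
Unset Strict Implicit.

Lemma mul_expRN_le (R : realType) (y : R) : y * expR (- y) <= expR (- 1).
Proof.
rewrite -(ler_pM2r (expR_gt0 y)) -mulrA -expRD addNr expR0 mulr1 -expRD.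
by have := expR_ge1Dx (- 1 + y); rewrite addrA subrr add0r.
Qed.

Definition cop_const (R : realType) : R :=
  1 / Num.sqrt ((Num.sqrt 2 - 1) * expR 1).

Lemma sqrt2_gt1 (R : realType) : 1 < Num.sqrt 2 :> R.
Proof. by rewrite -[ltLHS]sqrtr1 ltr_sqrt // ltr1n. Qed.

Lemma cop_const_gt0 (R : realType) : 0 < cop_const R.
Proof.
by rewrite divr_gt0 // sqrtr_gt0 mulr_gt0 ?expR_gt0 // subr_gt0 sqrt2_gt1.
Qed.

Lemma cop_const_sqr (R : realType) :
  cop_const R ^+ 2 * (Num.sqrt 2 - 1) * expR 1 = 1.
Proof.
have p0 : 0 < (Num.sqrt 2 - 1) * expR 1 :> R.
  by rewrite mulr_gt0 ?expR_gt0 // subr_gt0 sqrt2_gt1.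
rewrite /cop_const expr_div_n expr1n sqr_sqrtr ?ltW // -mulrA mulrAC mulrC mul1r.
by rewrite mulrC mulfV // gt_eqF.
Qed.

(* The number of guards used before each of them only removes two moves is
   [t * sqrt n]: by induction the quotients by nontrivial subgroups leave room for
   [t * sqrt n] further cops, as [c * sqrt (n / 2) + t * sqrt n = c * sqrt n].
   The decayed number of moves is then at most [max_k (k * exp (- k t / sqrt n))
   = sqrt n / (t e)], and [c] solves [t + 1 / (2 t e) = c]. *)
Definition guard_const (R : realType) : R :=
  (1 - (Num.sqrt 2)^-1) * cop_const R.

Lemma guard_const_gt0 (R : realType) : 0 < guard_const R.
Proof.
rewrite mulr_gt0 ?cop_const_gt0 // subr_gt0 invf_lt1 ?sqrt2_gt1 //.
exact: lt_trans (sqrt2_gt1 R).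
Qed.

Lemma guard_constE (R : realType) :
  2 * (cop_const R - guard_const R) = (guard_const R)^-1 * expR (- 1).
Proof.
have s0 : Num.sqrt 2 != 0 :> R by rewrite gt_eqF // (lt_trans _ (sqrt2_gt1 R)).
have t0 := guard_const_gt0 R.
have te : guard_const R * expR 1 != 0 by rewrite gt_eqF // mulr_gt0 ?expR_gt0.
rewrite expRN -invfM; apply: (mulIf te); rewrite mulVf // -[RHS](cop_const_sqr R).
have ss : Num.sqrt 2 ^+ 2 = 2 :> R by rewrite sqr_sqrtr.
by rewrite /guard_const -{1}ss; field.
Qed.

Variables (G : finZmodType) (S : {set G}) (I : finType).
Hypotheses (Sgen : <<S>>%g = [set: G]) (SN : forall u, u \in S -> - u \in S).

Lemma cops_force_sqrt (R : realType) (H : {group G}) :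
  cops_force (0 |: S) I H S
    (Num.trunc (cop_const R * Num.sqrt (#|G|%:R / #|H|%:R) + 7 / 2)).
Proof.
have S00 : 0 \in 0 |: S by rewrite setU11.
have S0S : S \subset 0 |: S by rewrite subsetUr.
set c := cop_const R; have c0 : 0 < c := cop_const_gt0 R.
set t := guard_const R; have t0 : 0 < t := guard_const_gt0 R.
have s0 : 0 < Num.sqrt 2 :> R := lt_trans ltr01 (sqrt2_gt1 R).
have [m] := ubnP (#|G| - #|H|)%N; elim: m H => // m IHm H ltm.
have H0 : 0 < #|H|%:R :> R by rewrite ltr0n cardG_gt0.
pose r : R := Num.sqrt (#|G|%:R / #|H|%:R); rewrite -/r.
have r0 : 0 <= r := sqrtr_ge0 _.
have cr0 : 0 <= c * r by rewrite mulr_ge0 // ltW.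
have [HG'|GH] := ltnP #|H| #|G|; last first.
  have HT : H :=: [set: G] by apply/eqP; rewrite eqEcard subsetT cardsT.
  apply: (@cops_force_leq _ _ _ _ _ 1%N).
    by rewrite truncn_ge_nat; move: cr0; lra.
  by move=> A d /card_gt0P[i Ai]; apply: (@win_hit _ _ _ _ _ _ _ i); rewrite ?HT.
have cr2 : c * (r / Num.sqrt 2) + t * r = c * r.
  by rewrite /t /guard_const -/c; ring.
have cs0 : 0 <= c * (r / Num.sqrt 2) by
  apply: mulr_ge0; [exact: ltW | apply: divr_ge0 => //; exact: ltW].
have add7 (x : R) : 0 <= x -> 0 <= x + 7 / 2 by lra.
have N0 := add7 _ cs0.
set M := Num.trunc (c * r + 7 / 2).
case NE : (Num.trunc (c * (r / Num.sqrt 2) + 7 / 2)) => [|N].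
  have : (1 <= Num.trunc (c * (r / Num.sqrt 2) + 7 / 2)%R)%N.
    by rewrite truncn_ge_nat //; move: cs0; lra.
  by rewrite NE.
have PK x : x \notin H -> cops_force (0 |: S) I (H <*> <[x]>)%G S N.+1.
  move=> xH; rewrite -NE.
  have := IHm (H <*> <[x]>)%G (leq_trans (codim_joing_cycle xH) ltm).
  apply: cops_force_leq; apply: le_truncn; rewrite lerD2r (ler_wpM2l (ltW c0)) //.
  rewrite /r -sqrtrV // -sqrtrM ?divr_ge0 // ler_sqrt; last first.
    by rewrite !mulr_ge0 ?invr_ge0.
  rewrite -mulrA -invfM ler_wpM2l // lef_pV2 ?posrE ?mulr_gt0 ?ltr0n ?cardG_gt0 //.
  by rewrite -natrM ler_nat mulnC card_joing_cycle.
have tr0 : 0 <= t * r by rewrite mulr_ge0 // ltW.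
(* Rounding up gives [t * r < J]; the extra guard fits since [N], not [N.+1], is added to [J]. *)
set J := (Num.trunc (t * r)).+1.
have /andP[Jr rJ] := truncn_itv tr0; rewrite -/J in rJ.
have NJM : (N + J <= M)%N.
  rewrite truncn_ge_nat; last exact: add7.
  rewrite addnS -addSn -NE natrD -cr2.
  by have /andP[] := truncn_itv N0; move: Jr; lra.
have [U [US cardU]] := cops_force_decay S00 S0S R HG' PK NJM.
apply.
(* Origin of [7 / 2]: [M > c * r + 5 / 2] and [J <= t * r + 1], while [cops_force_half] needs
   [#|U| <= 2 * (M - J) - 3]. As [5 - 2 = 3], [#|U| <= 2 * (c - t) * r] suffices. *)
have MJ : (#|U| + 3 + 2 * J < 2 * M)%N.
  have /andP[_ rM] := truncn_itv (add7 _ cr0).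
  rewrite -/M in rM.
  rewrite -(ltr_nat R) !natrD !natrM.
  have JE : J%:R = (Num.trunc (t * r))%:R + 1 :> R by rewrite -natr1.
  suff : #|U|%:R <= 2 * (c - t) * r by move: rM Jr JE; rewrite -natr1; lra.
  have HC : #|H|%:R <= #|cop_cosets (0 |: S) H|%:R :> R.
    have [V [_ le _]] := ex_transversal S00 S0S H.
    by rewrite ler_nat (leq_trans _ le) // leq_addl.
  have G0 : 0 < #|G|%:R :> R by rewrite (lt_trans H0) // ltr_nat.
  apply: le_trans cardU _.
  set k := (_ - _) / #|H|%:R; set q := (_ - _) / #|G|%:R.
  have rp : 0 < r by rewrite sqrtr_gt0 divr_gt0.
  have q0 : 0 <= q by rewrite divr_ge0 ?subr_ge0.
  have k0 : 0 <= k by rewrite divr_ge0 ?subr_ge0.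
  have kE : k = q * r ^+ 2.
    rewrite sqr_sqrtr ?divr_ge0 // /k /q; field.
    by rewrite !gt_eqF.
  have -> : 2 * (c - t) * r = r / t * expR (- 1).
    by rewrite guard_constE -/t; ring.
  apply: le_trans (ler_wpM2l _ (mul_expRN_le (q * (t * r)))); last first.
    by rewrite divr_ge0 // ltW.
  have -> : r / t * (q * (t * r) * expR (- (q * (t * r)))) =
            k * expR (- (q * (t * r))).
    by rewrite kE; field; rewrite gt_eqF.
  by rewrite ler_wpM2l // ler_expR lerN2 ler_wpM2l // ltW.
have split_cops (u j n : nat) : (u + 3 + 2 * j < 2 * n)%N ->
    (u <= 2 * (n - j - 2) + 1)%N /\ (n - j = (n - j - 2).+2)%N by clear; lia.
have [cardU2 ->] := split_cops _ _ _ MJ.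
exact: (cops_force_half S00 S0S Sgen SN).
Qed.
End Bound.

(** * From differences to a strategy on the Cayley graph *)

Section Strategy.
Set Implicit Arguments.
Unset Strict Implicit.
Variables (G : finZmodType) (S : {set G}) (k : nat).
Implicit Types (d c s : 'I_k -> G) (v : G).

(** A form of [win] with bounded duration, so that a strategy can carry the number of turns left as
    data. *)
Fixpoint wins_in (t : nat) d : Prop :=
  (exists i, d i = 0) \/
  if t is t'.+1 then
    forall v, v \in 0 |: S -> exists s, (forall i, s i \in 0 |: S) /\
      wins_in t' (fun i => d i + v - s i)
  else False.

Lemma wins_in_hit t d i : d i = 0 -> wins_in t d.
Proof. by case: t => [|t] di; left; exists i. Qed.

Lemma wins_in_leq t t' d : (t <= t')%N -> wins_in t d -> wins_in t' d.
Proof.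
elim: t t' d => [|t IHt] [|t'] d //= tt' [[i di]|]; try by left; exists i.
  by [].
move=> w; right=> v /w[s [Ss ws]]; exists s; split=> //; exact: IHt ws.
Qed.

Lemma win_wins_in d :
  win (0 |: S) 1%G S [set: 'I_k] d -> exists t, wins_in t d.
Proof.
elim=> {}d => [i _ di|s Ss _ IH].
  exists 0%N; apply: (@wins_in_hit _ _ i).
  by apply/eqP; move: di; rewrite inE.
have /choice[f fP] : forall v, exists t, v \in 0 |: S ->
    wins_in t (fun i => d i + v - s v i).
  move=> v; have [Sv|_] := boolP (v \in 0 |: S); last by exists 0%N.
  have /IH[t wt] : robber_move (0 |: S) 1%G S v.
    rewrite /robber_move Sv /=; case/setU1P: Sv => [->|Sv].
      by rewrite group_add0.
    apply/orP; right; apply/exists_inP; exists v => //.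
    by rewrite subrr group_add0.
  by exists t.
exists (\max_v f v)%N.+1; right=> v Sv; exists (s v); split=> //.
by apply: wins_in_leq (fP v Sv); apply: leq_bigmax.
Qed.

Lemma may_move_Cay u v : may_move (Cay S) u v = (v - u \in 0 |: S).
Proof. by rewrite /may_move /Cay in_setU1 subr_eq0. Qed.

(* The cops stay at [0] until the robber is placed, which determines how many
   turns they need; they then follow the moves that witness [wins_in]. *)
Lemma win_cops_win :
  (forall d, win (0 |: S) 1%G S [set: 'I_k] d) -> cops_win (Cay S) k.
Proof.
move=> W.
have /choice[T TP] : forall r : G, exists t, wins_in t (fun=> r - 0).
  by move=> r; apply: win_wins_in.
have S00 : 0 \in 0 |: S by rewrite setU11.
(* [p] holds the turns left after this one, the differences and the robber's move. Steps must be
   legal even from lost positions, where the cops stand still. *)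
have /choice[mu muP] : forall p : nat * ('I_k -> G) * G, exists s,
    (forall i, s i \in 0 |: S) /\
    (p.2 \in 0 |: S -> wins_in p.1.1.+1 p.1.2 ->
      (exists i, p.1.2 i = 0) \/ wins_in p.1.1 (fun i => p.1.2 i + p.2 - s i)).
  move=> [[t d] v] /=; have [[Sv [hit|/(_ v Sv)[s [Ss ws]]]]|nw] :=
    pselect (v \in 0 |: S /\ wins_in t.+1 d).
  - by exists (fun=> 0); split=> // _ _; left.
  - by exists s; split=> // _ _; right.
  - by exists (fun=> 0); split=> // Sv wd; case: nw.
(* The state holds the robber's last position ([None] before he is placed), the cops' positions and
   the turns left. *)
pose step (st : option G * ('I_k -> G) * nat) (r' : G) :=
  if st.1.1 is Some r then
    (Some r',
     fun i => st.1.2 i + mu (st.2.-1, fun j => r - st.1.2 j, r' - r) i, st.2.-1)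
  else (Some r', st.1.2, T r').
pose st (h : seq G) := foldl step (None, fun=> 0, 0%N) h.
have stS r n : st (mkseq r n.+1) = step (st (mkseq r n)) (r n).
  by rewrite /st mkseqS foldl_rcons.
exists (fun h => finfun (st h).1.2); split=> [r _ t i|r rP].
  rewrite may_move_Cay /cops_at !ffunE stS /step.
  case: (st _).1.1 => [r'|] /=; last by rewrite subrr.
  by rewrite addrAC subrr add0r; exact: (muP (_, _, _)).1.
suff cap t n c : st (mkseq r n.+1) = (Some (r n), c, t) ->
    wins_in t (fun i => r n - c i) -> captures (fun h => finfun (st h).1.2) r.
  exact: (cap (T (r 0%N)) 0%N (fun=> 0) erefl (TP (r 0%N))).
elim: t n c => [|t IHt] n c stn wn.
  case: wn => // -[i /subr0_eq rc]; exists n, i; right.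
  by rewrite /cops_at ffunE stn.
have Sv : r n.+1 - r n \in 0 |: S by rewrite -may_move_Cay.
have [_ /(_ Sv wn)[[i /subr0_eq rc]|wt]] := muP (t, fun i => r n - c i, r n.+1 - r n).
  by exists n, i; right; rewrite /cops_at ffunE stn.
apply: (IHt n.+1 (fun i => c i + mu (t, fun i => r n - c i, r n.+1 - r n) i)).
  by rewrite stS stn.
move: wt => /=; congr (wins_in t _); apply/funext => i /=.
by rewrite (AC ((2*2)*1) ((3*(2*5))*(1*4))) /= subrr addr0 -opprD.
Qed.

End Strategy.

Theorem theorem3p8 (R : realType) (G : finZmodType) (S : {set G})
    (Sgen : <<S>>%g = [set: G])
    (Sopp : S = [set - x | x in S])
    (S0 : 0 \notin S) :
  (cop_number (Cay S))%:R <=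
    1 / Num.sqrt ((Num.sqrt 2 - 1) * expR 1) * Num.sqrt #|G|%:R + 7 / 2 :> R.
Proof.
have SN u : u \in S -> - u \in S by move=> Su; rewrite Sopp imset_f.
set x := (_ + _ : R); have x0 : 0 <= x.
  rewrite addr_ge0 ?divr_ge0 // mulr_ge0 ?sqrtr_ge0 //.
  exact: ltW (cop_const_gt0 R).
suff win_x : cops_win (Cay S) (Num.trunc x).
  have [_ /(_ _ win_x)] := cop_numberP (Cay S).
  by rewrite truncn_ge_nat.
apply: win_cops_win => d.
have := @cops_force_sqrt _ _ 'I_(Num.trunc x) Sgen SN R 1%G.
rewrite cards1 divr1; apply.
by rewrite cardsT card_ord.
Qed.
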